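(* Let $\mathcal{A}$ be a separable class of diffusion coefficients generated by $\mathcal{A}_0$, let $\mathcal{P}=\{\mathbb{P}^a:a\in\mathcal{A}\}$, and let $X$ be an $\hat{\mathbb{F}}^{\mathcal{P}}$-progressively measurable process with values in $\mathbb{R}^n$. Assume that for some $p>1$, $X_t\in\hat{\mathbb{L}}^p$ for all $t\ge0$, and that for every $a\in\mathcal{A}$ there are constants $c_a,\varepsilon_a>0$ such that $$\mathbb{E}^{\mathbb{P}^a}\big[|X_t-X_s|^p\big]\le c_a|t-s|^{n+\varepsilon_a}\quad\text{for all }s,t\ge0.$$ Then $X$ admits an $\hat{\mathbb{F}}^{\mathcal{P}}$-progressively measurable version $\tilde X$ which is Hölder continuous, $\mathcal{P}$-q.s. (with Hölder exponent $\alpha_a<\varepsilon_a/p$, $\mathbb{P}^a$-almost surely for every $a\in\mathcal{A}$).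
   Context: Canonical space. $\Omega=\{\omega\in C(\mathbb{R}_+,\mathbb{R}^d):\omega(0)=0\}$, $B$ is the canonical process, $\mathbb{F}=\{\mathcal{F}_t\}_{t\ge0}$ the (raw) filtration generated by $B$, $\mathcal{F}_\infty=\bigvee_t\mathcal{F}_t$, $\mathcal{F}^+_t=\bigcap_{s>t}\mathcal{F}_s$, and $\mathcal{T}$ is the set of $\mathbb{F}$-stopping times with values in $[0,\infty]$. For a probability measure $\mathbb{P}$ on $\mathcal{F}_\infty$ and a sub-$\sigma$-algebra $\mathcal{G}$, $\mathcal{N}^{\mathbb{P}}(\mathcal{G})=\{E\subset\Omega:\ E\subset\tilde E\text{ for some }\tilde E\in\mathcal{G}\text{ with }\mathbb{P}[\tilde E]=0\}$, and $\mathcal{F}^{\mathbb{P}}_t=\mathcal{F}^+_t\vee\mathcal{N}^{\mathbb{P}}(\mathcal{F}^+_t)$. Each $\mathbb{P}$ is extended to its completion. $\mathbb{S}^{>0}_d$ is the set of symmetric positive definite $d\times d$ matrices. Local martingale measures. $\mathbb{P}$ is a local martingale measure if $B$ is a $\mathbb{P}$-local martingale. There is (Karandikar) an $\mathbb{F}$-progressively measurable pathwise-defined process $\int_0^tB_sdB_s$ coinciding with the Itô integral $\mathbb{P}$-a.s. for all local martingale measures $\mathbb{P}$; it yields a universal quadratic variation $\langle B\rangle_t=B_tB_t^T-2\int_0^tB_sdB_s$ ($d\times d$ symmetric-matrix valued), equal $\mathbb{P}$-a.s. to the $\mathbb{P}$-quadratic variation of $B$ for each such $\mathbb{P}$, and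 $\hat a_t:=\limsup_{\varepsilon\downarrow0}\frac1\varepsilon[\langle B\rangle_t-\langle B\rangle_{t-\varepsilon}]$. $\overline{\mathcal{P}}_W$ is the set of local martingale measures $\mathbb{P}$ such that, $\mathbb{P}$-a.s., $\langle B\rangle_t$ is absolutely continuous in $t$ and $\hat a$ takes values in $\mathbb{S}^{>0}_d$. Diffusion coefficients. $\overline{\mathcal{A}}$ is the set of $\mathbb{F}$-progressively measurable $\mathbb{S}^{>0}_d$-valued processes $a$ with $\int_0^t|a_s|ds<\infty$ for all $t\ge0$; $\overline{\mathcal{A}}_W(\mathbb{P})=\{a\in\overline{\mathcal{A}}:a=\hat a,\ dt\times d\mathbb{P}\text{-a.e.}\}$; $\overline{\mathcal{A}}_W=\bigcup_{\mathbb{P}\in\overline{\mathcal{P}}_W}\overline{\mathcal{A}}_W(\mathbb{P})$. For $a\in\overline{\mathcal{A}}_W$, $\tau_1\le\tau_2$ in $\mathcal{T}$ and a probability measure $\mathbb{P}^1$ on $\mathcal{F}_{\tau_1}$, a probability measure $\mathbb{P}$ is a weak solution of $dX_t=a_t^{1/2}(X_\cdot)dB_t$ on $[\tau_1,\tau_2]$ with initial condition $\mathbb{P}^1$ if $\mathbb{P}=\mathbb{P}^1$ on $\mathcal{F}_{\tau_1}$, $B$ is a $\mathbb{P}$-local martingale on $[\tau_1,\tau_2]$, and $W_t=\int_{\tau_1}^ta_s^{-1/2}(B_\cdot)dB_s$, $t\in[\tau_1,\tau_2]$, is a $\mathbb{P}$-Brownian motion. The equation has weak uniqueness if for all $\tau_1\le\tau_2$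 in $\mathcal{T}$ and all $\mathbb{P}^1$ on $\mathcal{F}_{\tau_1}$ any two such weak solutions agree on $\mathcal{F}_{\tau_2}$. $\mathcal{A}_W$ is the set of $a\in\overline{\mathcal{A}}_W$ for which weak uniqueness holds, and for $a\in\mathcal{A}_W$, $\mathbb{P}^a\in\overline{\mathcal{P}}_W$ is the unique weak solution on $\mathbb{R}_+$ with $\mathbb{P}^a(B_0=0)=1$. Separable classes. Let $\theta^{a,b}=\inf\{t\ge0:\int_0^ta_sds\ne\int_0^tb_sds\}$, $\inf\emptyset=\infty$. $\mathcal{A}_0\subset\mathcal{A}_W$ is a generating class of diffusion coefficients if (i) $a\mathbf{1}_{[0,t)}+b\mathbf{1}_{[t,\infty)}\in\mathcal{A}_0$ for all $a,b\in\mathcal{A}_0$, $t\ge0$; (ii) for all $a,b\in\mathcal{A}_0$, $\theta^{a,b}$ is a constant. $\mathcal{A}$ is the separable class of diffusion coefficients generated by $\mathcal{A}_0$ if $\mathcal{A}_0$ is a generating class and $\mathcal{A}$ consists of all processes $a=\sum_{n=0}^\infty\sum_{i=1}^\infty a^n_i\mathbf{1}_{E^n_i}\mathbf{1}_{[\tau_n,\tau_{n+1})}$ where $a^n_i\in\mathcal{A}_0$; $(\tau_n)_n\subset\mathcal{T}$ is nondecreasing, $\tau_0=0$, $\inf\{n:\tau_n=\infty\}<\infty$, $\tau_n<\tau_{n+1}$ whenever $\tau_n<\infty$, each $\tau_n$ takes at most countably many values; and for each $n$, $\{E^n_i,i\ge1\}\subset\mathcal{F}_{\tau_n}$ is a partition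 of $\Omega$. (One has $\mathcal{A}\subset\mathcal{A}_W$, so $\mathbb{P}^a$ is defined for $a\in\mathcal{A}$.) Quasi-sure notions. A property holds $\mathcal{P}$-q.s. if it holds $\mathbb{P}$-a.s. for all $\mathbb{P}\in\mathcal{P}$; $\mathcal{N}_{\mathcal{P}}=\bigcap_{\mathbb{P}\in\mathcal{P}}\mathcal{N}^{\mathbb{P}}(\mathcal{F}_\infty)$; $\hat{\mathbb{F}}^{\mathcal{P}}=\{\hat{\mathcal{F}}^{\mathcal{P}}_t\}_{t\ge0}$ with $\hat{\mathcal{F}}^{\mathcal{P}}_t=\bigcap_{\mathbb{P}\in\mathcal{P}}(\mathcal{F}^{\mathbb{P}}_t\vee\mathcal{N}_{\mathcal{P}})$; $\hat{\mathcal{F}}^{\mathcal{P}}_\infty$ is given by the same formula with $t=\infty$ and $\mathcal{F}^+_\infty=\mathcal{F}_\infty$. $\hat{\mathbb{L}}^p$ is the set of $\hat{\mathcal{F}}^{\mathcal{P}}_\infty$-measurable random variables $\xi$ (of the appropriate dimension) with $\mathbb{E}^{\mathbb{P}}[|\xi|^p]<\infty$ for all $\mathbb{P}\in\mathcal{P}$. A version $\tilde X$ of $X$ means a modification: for each $t\ge 0$, $\tilde X_t=X_t$, $\mathcal{P}$-q.s. Hölder continuity of paths on $\mathbb{R}_+$ is understood on compact time intervals. *)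

(* Defs.v *)
From HB Require Import structures.
From mathcomp Require Import all_boot all_order all_algebra.
From mathcomp Require Import all_classical all_reals all_analysis.
Import Order.TTheory GRing.Theory Num.Theory numFieldNormedType.Exports.

Set Implicit Arguments.
Unset Strict Implicit.
Unset Printing Implicit Defensive.

Local Open Scope classical_set_scope.
Local Open Scope ring_scope.

(** * Canonical space *)

(* A path in C(R_+, R^d) started at 0 is represented by its extension to R by
   0 on the negative half-line, which makes the representation unique. *)
Definition is_path (R : realType) (d : nat) (w : R -> 'cV[R]_d) : Prop :=
  continuous w /\ forall t, t <= 0 -> w t = 0.

Definition path_space (R : realType) (d : nat) : Type :=
  {w : R -> 'cV[R]_d | is_path w}.

Lemma is_path0 (R : realType) (d : nat) : is_path (fun _ : R => 0 : 'cV[R]_d).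
Proof. by split=> // t; exact: cvg_cst. Qed.

HB.instance Definition _ (R : realType) (d : nat) :=
  gen_eqMixin (path_space R d).
HB.instance Definition _ (R : realType) (d : nat) :=
  gen_choiceMixin (path_space R d).
HB.instance Definition _ (R : realType) (d : nat) :=
  isPointed.Build (path_space R d) (exist _ _ (is_path0 R d)).

Definition B (R : realType) (d : nat) (t : R) (w : path_space R d) : 'cV[R]_d :=
  proj1_sig w t.

Definition F (R : realType) (d : nat) (t : R) : set (set (path_space R d)) :=
  <<s [set E | exists (s : R) (i : 'I_d) (U : set R),
        [/\ 0 <= s, s <= t, measurable U & E = [set w | U (B s w i ord0)]]] >>.

Definition F_gen (R : realType) (d : nat) : set (set (path_space R d)) :=
  \bigcup_(t in [set t : R | 0 <= t]) @F R d t.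

Definition Finf (R : realType) (d : nat) : set (set (path_space R d)) :=
  <<s @F_gen R d >>.

(* path_space with F_oo as its sigma-algebra *)
Definition Omega (R : realType) (d : nat) := g_sigma_algebraType (@F_gen R d).

Definition Fplus (R : realType) (d : nat) (t : R) : set (set (Omega R d)) :=
  \bigcap_(s in [set s : R | t < s]) @F R d s.

(* Time runs through R; all requirements only concern times t >= 0. *)
Definition process (R : realType) (d : nat) (V : Type) : Type :=
  R -> Omega R d -> V.

Definition mfun_wrt (R : realType) (T : pointedType) (k l : nat)
    (G : set (set T)) (f : T -> 'M[R]_(k, l)) : Prop :=
  forall i j, measurable_fun setT
    (fun w : g_sigma_algebraType G => f w i j : R).

Definition progressive (R : realType) (d k l : nat)
    (G : R -> set (set (Omega R d))) (X : process R d 'M[R]_(k, l)) : Prop :=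
  forall t, 0 <= t -> forall i j,
    @measurable_fun _ _ (measurableTypeR R * g_sigma_algebraType (G t))%type
      (measurableTypeR R) (`[0, t] `*` setT) (fun z => X z.1 z.2 i j).

Definition stopping_time (R : realType) (d : nat) (tau : Omega R d -> \bar R)
    : Prop :=
  (forall w, (0 <= tau w)%E) /\
  forall t, 0 <= t -> @F R d t [set w | (tau w <= t%:E)%E].

Definition F_stop (R : realType) (d : nat) (tau : Omega R d -> \bar R)
    : set (set (Omega R d)) :=
  [set E | @Finf R d E /\
     forall t, 0 <= t -> @F R d t (E `&` [set w | (tau w <= t%:E)%E])].

Definition tmin (R : realType) (t : R) (T : \bar R) : R := fine (mine t%:E T).

(** * Local martingales *)

(* E[M_t | F_s] = M_s, spelled out on the events of F_s *)
Definition martingale (R : realType) (d : nat) (P : probability (Omega R d) R)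
    (M : process R d R) : Prop :=
  [/\ forall t, 0 <= t ->
        measurable_fun setT (M t : g_sigma_algebraType (@F R d t) -> R),
      forall t, 0 <= t -> P.-integrable setT (EFin \o M t) &
      forall s t E, 0 <= s -> s <= t -> @F R d s E ->
        (\int[P]_(w in E) (M t w)%:E = \int[P]_(w in E) (M s w)%:E)%E].

(* Only used for processes started at 0. *)
Definition local_martingale (R : realType) (d : nat)
    (P : probability (Omega R d) R) (M : process R d R) : Prop :=
  exists sigma : nat -> Omega R d -> \bar R,
    [/\ forall k, stopping_time (sigma k),
        forall k w, (sigma k w <= sigma k.+1 w)%E,
        {ae P, forall w, (sigma k w) @[k --> \oo] --> +oo%E} &
        forall k, martingale P (fun t w => M (tmin t (sigma k w)) w)].

Definition local_martingale_measure (R : realType) (d : nat)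
    (P : probability (Omega R d) R) : Prop :=
  forall i, local_martingale P (fun t w => B t w i ord0).

Definition continuous_paths (R : realType) (d k l : nat)
    (P : probability (Omega R d) R) (X : process R d 'M[R]_(k, l)) : Prop :=
  {ae P, forall w, {within `[0, +oo[, continuous (fun t : R => X t w)}}.

(** * Symmetric matrices *)

Definition psd (R : realType) (d : nat) (S : 'M[R]_d) : Prop :=
  S^T = S /\ forall x : 'cV[R]_d, 0 <= (x^T *m S *m x) ord0 ord0.

Definition posdef (R : realType) (d : nat) (S : 'M[R]_d) : Prop :=
  S^T = S /\
  forall x : 'cV[R]_d, x != 0 -> 0 < (x^T *m S *m x) ord0 ord0.

(* the symmetric positive definite square root (meaningful on posdef S) *)
Definition sqrtmx (R : realType) (d : nat) (S : 'M[R]_d) : 'M[R]_d :=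
  xget 0 [set Q : 'M[R]_d | posdef Q /\ Q *m Q = S].

(** * Universal quadratic variation *)

(* Karandikar's times: t_0 = 0 and t_(i+1) is the first time after t_i at which
   the path has moved by 2^-n. *)
Fixpoint ktime (R : realType) (d : nat) (w : Omega R d) (n i : nat) : \bar R :=
  if i is i'.+1 then
    ereal_inf [set s%:E | s in [set s : R | (ktime w n i' <= s%:E)%E /\
      2^-1 ^+ n <= `|B s w - B (fine (ktime w n i')) w|]]
  else 0%E.

(* the Riemann sum approximating int_0^t B^i dB^j; only finitely many terms are
   nonzero *)
Definition ksum (R : realType) (d : nat) (w : Omega R d) (n : nat) (t : R)
    (i j : 'I_d) : R :=
  limn (fun N : nat => \sum_(0 <= k < N)
    B (tmin t (ktime w n k)) w i ord0 *
    (B (tmin t (ktime w n k.+1)) w j ord0 - B (tmin t (ktime w n k)) w j ord0)).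

(* Karandikar's pathwise integral, (i, j) entry: int_0^t B^i dB^j *)
Definition intBdB (R : realType) (d : nat) : process R d 'M[R]_d :=
  fun t w => \matrix_(i, j)
    fine (limn_esup (fun n => (ksum w n t i j)%:E)).

(* B B^T - 2 int B dB, where the matrix integral 2 int B dB is the symmetric
   matrix with entries int B^i dB^j + int B^j dB^i *)
Definition QV (R : realType) (d : nat) : process R d 'M[R]_d :=
  fun t w => B t w *m (B t w)^T - (intBdB t w + (intBdB t w)^T).

Definition ahat (R : realType) (d : nat) : process R d 'M[R]_d :=
  fun t w => \matrix_(i, j)
    fine (limf_esup
      (fun e : R => (e^-1 * (QV t w i j - QV (t - e) w i j))%:E) 0^'+).

Definition abs_continuous (R : realType) (d : nat) (f : R -> 'M[R]_d) : Prop :=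
  forall T e : R, 0 < T -> 0 < e -> exists2 delta : R, 0 < delta &
    forall (m : nat) (s t : nat -> R),
      (forall k, (k < m)%N -> [/\ 0 <= s k, s k <= t k & t k <= T]) ->
      (forall k l, (k < l)%N -> (l < m)%N -> t k <= s l) ->
      \sum_(k < m) (t k - s k) < delta ->
      \sum_(k < m) `|f (t k) - f (s k)| < e.

(* <B> is differentiable only for almost every t, so that the condition on
   ahat is imposed for almost every t. *)
Definition Pbar_W (R : realType) (d : nat) : set (probability (Omega R d) R) :=
  [set P | local_martingale_measure P /\
    {ae P, forall w, abs_continuous (fun t => QV t w) /\
       {ae lebesgue_measure, forall t : R, 0 <= t -> posdef (ahat t w)}}].

(** * Diffusion coefficients *)

Definition Abar (R : realType) (d : nat) : set (process R d 'M[R]_d) :=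
  [set a | [/\ progressive (@F R d) a,
     forall t w, 0 <= t -> posdef (a t w) &
     forall t w, 0 <= t ->
       (\int[lebesgue_measure]_(s in `[0%R, t]) (`|a s w|)%:E < +oo)%E]].

Definition Abar_W_of (R : realType) (d : nat) (P : probability (Omega R d) R)
    : set (process R d 'M[R]_d) :=
  [set a | @Abar R d a /\
    {ae (lebesgue_measure \x P)%E, forall z : R * Omega R d,
       0 <= z.1 -> a z.1 z.2 = ahat z.1 z.2}].

Definition Abar_W (R : realType) (d : nat) : set (process R d 'M[R]_d) :=
  \bigcup_(P in @Pbar_W R d) Abar_W_of P.

(** * Ito integral *)

(* C is (a version, progressive for the raw filtration, of) the P-quadratic
   variation of the continuous local martingale M *)
Definition is_qvar (R : realType) (d : nat) (P : probability (Omega R d) R)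
    (M : process R d 'cV[R]_d) (C : process R d 'M[R]_d) : Prop :=
  [/\ progressive (@F R d) C,
      continuous_paths P C,
      {ae P, forall w, C 0 w = 0 /\
         forall s t, 0 <= s -> s <= t -> psd (C t w - C s w)} &
      forall i j, local_martingale P
        (fun t w => M t w i ord0 * M t w j ord0 - C t w i j)].

Record simple_integrand (R : realType) (d : nat) := SimpleIntegrand {
  si_size : nat ;
  si_grid : nat -> R ;
  si_coef : nat -> Omega R d -> 'M[R]_d }.

Definition si_valid (R : realType) (d : nat) (K : simple_integrand R d) : Prop :=
  [/\ 0 <= si_grid K 0,
      forall k, si_grid K k <= si_grid K k.+1,
      forall k, mfun_wrt (@F R d (si_grid K k)) (si_coef K k) &
      exists c : R, forall k w, `|si_coef K k w| <= c].

Definition si_value (R : realType) (d : nat) (K : simple_integrand R d)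
    : process R d 'M[R]_d :=
  fun s w => \sum_(k < si_size K)
    if si_grid K k < s <= si_grid K k.+1 then si_coef K k w else 0.

Definition si_integral (R : realType) (d : nat) (K : simple_integrand R d)
    (M : process R d 'cV[R]_d) : process R d 'cV[R]_d :=
  fun t w => \sum_(k < si_size K) si_coef K k w *m
    (M (Num.min t (si_grid K k.+1)) w - M (Num.min t (si_grid K k)) w).

(* tr (int_0^t D dC D^T) <= e for matrix-valued functions C and D of time, where
   dC is written as Q dA with Q positive semidefinite and A nondecreasing. *)
Definition energy_le (R : realType) (d : nat) (C D : R -> 'M[R]_d) (t e : R)
    : Prop :=
  exists (A : cumulative R R) (Q : R -> 'M[R]_d),
    [/\ forall i j, measurable_fun setT (fun s : R => Q s i j : R),
        forall s, psd (Q s),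
        forall s i j, 0 <= s ->
          (lebesgue_stieltjes_measure A).-integrable `]0, s]
            (fun u => (Q u i j)%:E) /\
          (C s i j)%:E =
            (\int[lebesgue_stieltjes_measure A]_(u in `]0%R, s]) (Q u i j)%:E)%E &
        (\int[lebesgue_stieltjes_measure A]_(u in `]0%R, t])
            (\tr (D u *m Q u *m (D u)^T))%:E <= e%:E)%E].

(* P-probability of the events E_k tends to 0 (through measurable hulls) *)
Definition prob_to0 (R : realType) (d : nat) (P : probability (Omega R d) R)
    (E : nat -> set (Omega R d)) : Prop :=
  exists E' : nat -> set (Omega R d),
    [/\ forall k, measurable (E' k), forall k, E k `<=` E' k &
        (P (E' k)) @[k --> \oo] --> 0%E].

(* I = int_0^. H dM for the continuous local martingale M: H is approximated by
   simple integrands K_k in the sense int_0^t |K_k - H|^2 d<M> -> 0 in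
   P-probability, and I is the limit of int K_k dM, uniformly on compact time
   intervals in P-probability. *)
Definition is_ito_integral (R : realType) (d : nat)
    (P : probability (Omega R d) R) (H : process R d 'M[R]_d)
    (M I : process R d 'cV[R]_d) : Prop :=
  [/\ progressive (@F R d) I,
      continuous_paths P I &
      exists (C : process R d 'M[R]_d) (K : nat -> simple_integrand R d),
        [/\ is_qvar P M C,
            forall k, si_valid (K k),
            forall t e, 0 <= t -> 0 < e -> prob_to0 P (fun k => [set w |
              ~ energy_le (fun s => C s w)
                  (fun s => si_value (K k) s w - H s w) t e]) &
            forall t e, 0 <= t -> 0 < e -> prob_to0 P (fun k => [set w |
              exists s, [/\ 0 <= s, s <= t &
                e <= `|si_integral (K k) M s w - I s w|]])]].

(** * Brownian motion *)

Definition brownian_motion (R : realType) (d : nat) (disp : measure_display)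
    (T : measurableType disp) (P : probability T R) (G : R -> set (set T))
    (beta : R -> T -> 'cV[R]_d) : Prop :=
  [/\ forall t, 0 <= t -> sigma_algebra setT (G t) /\ G t `<=` measurable,
      forall s t, 0 <= s -> s <= t -> G s `<=` G t,
      forall t, 0 <= t -> mfun_wrt (G t) (beta t),
      {ae P, forall z, beta 0 z = 0 /\
         {within `[0, +oo[, continuous (fun t : R => beta t z)}} &
      (* beta_t - beta_s is independent of G_s with law N(0, (t - s) I_d) *)
      forall (s t : R) (E : set T) (U : 'I_d -> set R),
        0 <= s -> s < t -> G s E -> (forall i, measurable (U i)) ->
        P (E `&` [set z | forall i, U i (beta t z i ord0 - beta s z i ord0)]) =
        (P E * \prod_(i < d) normal_prob 0 (Num.sqrt (t - s)) (U i))%E].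

(* W is a P-Brownian motion on [tau1, tau2] (stopped at both ends): it has the
   increments of a Brownian motion that lives on an extension, through the map
   p, of the filtered space. The extension is needed because Omega need not carry a
   Brownian motion outside of [tau1, tau2]. *)
Definition brownian_on (R : realType) (d : nat) (P : probability (Omega R d) R)
    (tau1 tau2 : Omega R d -> \bar R) (W : process R d 'cV[R]_d) : Prop :=
  exists (disp : measure_display) (T : measurableType disp)
      (P' : probability T R) (p : T -> Omega R d)
      (G : R -> set (set T)) (beta : R -> T -> 'cV[R]_d),
    [/\ measurable_fun setT p,
        forall E, measurable E -> P' (p @^-1` E) = P E,
        forall t E, 0 <= t -> @F R d t E -> G t (p @^-1` E),
        brownian_motion P' G beta &
        {ae P', forall z, forall t, 0 <= t ->
           W t (p z) =
             beta (tmin t (tau2 (p z))) z - beta (tmin t (tau1 (p z))) z}].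

(** * Weak solutions *)

Definition B_between (R : realType) (d : nat) (tau1 tau2 : Omega R d -> \bar R)
    : process R d 'cV[R]_d :=
  fun t w => B (tmin t (tau2 w)) w - B (tmin t (tau1 w)) w.

Definition weak_solution (R : realType) (d : nat) (a : process R d 'M[R]_d)
    (tau1 tau2 : Omega R d -> \bar R)
    (P1 : probability (g_sigma_algebraType (F_stop tau1)) R)
    (P : probability (Omega R d) R) : Prop :=
  [/\ forall E, F_stop tau1 E -> P E = P1 E,
      forall i, local_martingale P (fun t w => B_between tau1 tau2 t w i ord0) &
      exists W : process R d 'cV[R]_d,
        is_ito_integral P (fun t w => invmx (sqrtmx (a t w)))
          (B_between tau1 tau2) W /\
        brownian_on P tau1 tau2 W].

Definition weak_uniqueness (R : realType) (d : nat) (a : process R d 'M[R]_d)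
    : Prop :=
  forall tau1 tau2 : Omega R d -> \bar R,
    stopping_time tau1 -> stopping_time tau2 ->
    (forall w, (tau1 w <= tau2 w)%E) ->
    forall (P1 : probability (g_sigma_algebraType (F_stop tau1)) R)
           (P Q : probability (Omega R d) R),
      weak_solution a tau2 P1 P -> weak_solution a tau2 P1 Q ->
      forall E, F_stop tau2 E -> P E = Q E.

Definition A_W (R : realType) (d : nat) : set (process R d 'M[R]_d) :=
  [set a | @Abar_W R d a /\ weak_uniqueness a].

(* P = P^a for a in A_W, where weak uniqueness makes such a P unique. *)
Definition is_law (R : realType) (d : nat) (a : process R d 'M[R]_d)
    (P : probability (Omega R d) R) : Prop :=
  @Pbar_W R d P /\
  exists P1 : probability (g_sigma_algebraType
                (F_stop (fun _ : Omega R d => 0%E : \bar R))) R,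
    P1 [set w | B 0 w = 0] = 1%E /\
    weak_solution a (fun _ => +oo%E) P1 P.

Definition laws (R : realType) (d : nat) (A : set (process R d 'M[R]_d))
    : set (probability (Omega R d) R) :=
  [set P | exists2 a, A a & is_law a P].

(** * Separable classes *)

Definition theta (R : realType) (d : nat) (a b : process R d 'M[R]_d)
    (w : Omega R d) : \bar R :=
  ereal_inf [set t%:E | t in [set t : R | 0 <= t /\ exists i j,
    (\int[lebesgue_measure]_(s in `[0%R, t]) a s w i j)%R <>
    (\int[lebesgue_measure]_(s in `[0%R, t]) b s w i j)%R]].

Definition generating_class (R : realType) (d : nat)
    (A0 : set (process R d 'M[R]_d)) : Prop :=
  [/\ A0 `<=` @A_W R d,
      forall a b t, A0 a -> A0 b -> 0 <= t ->
        A0 (fun s w => if s < t then a s w else b s w) &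
      forall a b, A0 a -> A0 b -> exists c, forall w, theta a b w = c].

(* For t >= 0 and w in Omega, exactly one term of the double series defining a
   is nonzero: the one with tau_n(w) <= t < tau_(n+1)(w) and w in E^n_i. *)
Definition separable_combination (R : realType) (d : nat)
    (A0 : set (process R d 'M[R]_d)) (a : process R d 'M[R]_d) : Prop :=
  exists (a_ : nat -> nat -> process R d 'M[R]_d)
      (tau : nat -> Omega R d -> \bar R) (E : nat -> nat -> set (Omega R d)),
    [/\ forall n i, A0 (a_ n i),
        [/\ forall n, stopping_time (tau n),
            forall w, tau 0%N w = 0%E,
            forall n w, (tau n w <= tau n.+1 w)%E &
            forall n w, (tau n w < +oo)%E -> (tau n w < tau n.+1 w)%E],
        (forall w, exists n, tau n w = +oo%E) /\
        (forall n, countable (range (tau n))),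
        forall n, [/\ forall i, F_stop (tau n) (E n i), trivIset setT (E n) &
                      \bigcup_i E n i = setT] &
        forall n i t w, 0 <= t -> (tau n w <= t%:E)%E -> (t%:E < tau n.+1 w)%E ->
          E n i w -> a t w = a_ n i t w].

Definition separable_class (R : realType) (d : nat)
    (A0 A : set (process R d 'M[R]_d)) : Prop :=
  generating_class A0 /\ A = [set a | separable_combination A0 a].

(** * Quasi-sure notions *)

Definition null_sets (R : realType) (d : nat) (P : probability (Omega R d) R)
    (G : set (set (Omega R d))) : set (set (Omega R d)) :=
  [set E | exists E', [/\ G E', P E' = 0%E & E `<=` E']].

Definition F_P (R : realType) (d : nat) (P : probability (Omega R d) R) (t : R)
    : set (set (Omega R d)) :=
  <<s @Fplus R d t `|` null_sets P (@Fplus R d t) >>.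

Definition Finf_P (R : realType) (d : nat) (P : probability (Omega R d) R)
    : set (set (Omega R d)) :=
  <<s @Finf R d `|` null_sets P (@Finf R d) >>.

Definition polar_sets (R : realType) (d : nat)
    (PP : set (probability (Omega R d) R)) : set (set (Omega R d)) :=
  \bigcap_(P in PP) null_sets P (@Finf R d).

Definition Fhat (R : realType) (d : nat)
    (PP : set (probability (Omega R d) R)) (t : R) : set (set (Omega R d)) :=
  \bigcap_(P in PP) <<s F_P P t `|` polar_sets PP >>.

Definition Fhat_inf (R : realType) (d : nat)
    (PP : set (probability (Omega R d) R)) : set (set (Omega R d)) :=
  \bigcap_(P in PP) <<s Finf_P P `|` polar_sets PP >>.

Definition quasi_surely (R : realType) (d : nat)
    (PP : set (probability (Omega R d) R)) (Q : Omega R d -> Prop) : Prop :=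
  forall P, PP P -> {ae P, forall w, Q w}.

(* Expectation under the completion of P: the integral of any F_oo-measurable
   function that is P-a.s. equal to f. *)
Definition expectation_compl (R : realType) (d : nat)
    (P : probability (Omega R d) R) (f : Omega R d -> R) : \bar R :=
  (\int[P]_w (xget (cst 0%R) [set g : Omega R d -> R |
     measurable_fun setT g /\ {ae P, forall w', f w' = g w'}] w)%:E)%E.

Definition Lhat (R : realType) (d n : nat)
    (PP : set (probability (Omega R d) R)) (p : R)
    : set (Omega R d -> 'cV[R]_n) :=
  [set xi : Omega R d -> 'cV[R]_n | mfun_wrt (Fhat_inf PP) xi /\
     forall P, PP P -> (expectation_compl P (fun w => (`|xi w| `^ p)%R) < +oo)%E].

Definition is_version (R : realType) (d n : nat)
    (PP : set (probability (Omega R d) R)) (Y X : process R d 'cV[R]_n) : Prop :=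
  forall t, 0 <= t -> quasi_surely PP (fun w => Y t w = X t w).

(* Hoelder continuity of exponent alpha on every compact time interval *)
Definition holder_path (R : realType) (n : nat) (alpha : R) (f : R -> 'cV[R]_n)
    : Prop :=
  forall T : R, 0 < T -> exists C : R, forall s t : R,
    0 <= s <= T -> 0 <= t <= T -> `|f t - f s| <= C * `|t - s| `^ alpha.

(* Main.v *)
(* The version is defined pathwise, with no reference to a measure:
   [Y t w] is the componentwise limsup of [X] along the dyadic approximations
   of [t] from below. Such approximations never look beyond [t], so [Y]
   inherits progressivity from [X] and no aggregation over the laws is needed.
   Under each law, [X] is a.s. equal at every fixed time to an
   [F_oo]-measurable variable [Z t], whose p-th moments of increments are
   controlled by the hypothesis. Kolmogorov's chaining argument then makes [X]
   Hoelder on dyadic times, so that [Y] is its continuous extension. As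
   [1 <= n], the exponent [1 + eps] needed for a one-dimensional time parameter
   is available. *)
Require Import Defs.
From mathcomp Require Import all_boot all_order all_algebra.
From mathcomp Require Import all_classical all_reals all_analysis measurable_realfun.
From mathcomp Require Import lra ring zify.
Import Order.TTheory GRing.Theory Num.Theory numFieldNormedType.Exports.
Local Open Scope classical_set_scope.
Local Open Scope ring_scope.

(** * Dyadic approximation and deterministic chaining *)

Lemma geometric_increments_cvg {R : realType} (D q : R) (u : R^nat) :
  0 <= D -> 0 < q -> q < 1 ->
  (forall m, `|u m.+1 - u m| <= D * q ^+ m) ->
  exists l, u @ \oo --> l /\ forall m, `|l - u m| <= D / (1 - q) * q ^+ m.
Proof.
move=> D0 q0 q1 du; have q1' : 0 < 1 - q by rewrite subr_gt0.
(* [K * q ^+ m] is the sum of all the increment bounds from index [m] on, hence the error bound at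
   [m]. *)
set K := D / (1 - q); have DK : D = K * (1 - q).
  by rewrite /K -mulrA mulVf ?mulr1 ?gt_eqF.
have K0 : 0 <= K by rewrite /K divr_ge0// ltW.
have stepq m : K * q ^+ m - K * q ^+ m.+1 = D * q ^+ m.
  by rewrite DK exprS; ring.
(* [v] increases, [w] decreases, and they squeeze the limit of [u]. *)
pose v m := u m - K * q ^+ m; pose w m := u m + K * q ^+ m.
have vS m : v m <= v m.+1.
  by have := du m; rewrite ler_norml /v => /andP[]; have := stepq m; lra.
have wS m : w m.+1 <= w m.
  by have := du m; rewrite ler_norml /w => /andP[]; have := stepq m; lra.
have vnd : {homo v : m n / (m <= n)%N >-> m <= n}.
  by apply: homo_leq => //; exact: le_trans.
have wni : {homo w : m n / (m <= n)%N >-> n <= m}.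
  by apply: homo_leq => // x y z /[swap]; exact: le_trans.
have vw m n : v m <= w n.
  have vwm k : v k <= w k.
    have : 0 <= K * q ^+ k by rewrite mulr_ge0// exprn_ge0// ltW.
    by rewrite /v /w; lra.
  have := vnd _ _ (leq_maxl m n); have := wni _ _ (leq_maxr m n).
  by have := vwm (maxn m n); lra.
have vub : has_ubound (range v) by exists (w 0%N) => _ [m _ <-].
have cv := nondecreasing_cvgn vnd vub.
exists (sup (range v)); split.
  have -> : u = v \+ geometric K q.
    by apply/funext => m; rewrite /v /geometric /=; ring.
  rewrite -[X in _ --> X]addr0; apply: cvgD => //.
  by apply: cvg_geometric; rewrite ger0_norm// ltW.
move=> m; rewrite ler_norml.
have : v m <= sup (range v) by apply: ub_le_sup => //; exists m.
have : sup (range v) <= w m.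
  by apply: ge_sup; [exists (v 0%N), 0%N | move=> _ [k _ <-]].
by rewrite /v /w; lra.
Qed.

Definition dyadic_floor {R : realType} (m : nat) (t : R) : R :=
  (Num.truncn (2 ^+ m * t))%:R / 2 ^+ m.

Lemma dyadic_floor_itv {R : realType} (m : nat) (t : R) : 0 <= t ->
  0 <= dyadic_floor m t <= t.
Proof.
move=> t0; rewrite /dyadic_floor divr_ge0//= ler_pdivrMr ?exprn_gt0//.
by rewrite mulrC truncn_le mulr_ge0.
Qed.

Lemma dyadic_floor_dist {R : realType} (m : nat) (t : R) : 0 <= t ->
  `|t - dyadic_floor m t| <= 2^-1 ^+ m.
Proof.
move=> t0; have /andP[_ le] := dyadic_floor_itv m t t0.
rewrite ger0_norm ?subr_ge0// lerBlDr exprVn -[X in X + _]div1r -mulrDl.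
rewrite ler_pdivlMr ?exprn_gt0// mulrC.
by have := truncnS_gt (2 ^+ m * t); rewrite -natr1; lra.
Qed.

Lemma measurable_dyadic_floor {R : realType} (m : nat) :
  measurable_fun setT (@dyadic_floor R m).
Proof.
apply: nondecreasing_measurable => // s t st.
rewrite /dyadic_floor ler_pM2r ?invr_gt0 ?exprn_gt0// ler_nat le_truncn//.
by rewrite ler_pM2l ?exprn_gt0.
Qed.

(** Used to refine the grid: from level [m] to [m.+1] the dyadic floor of a time either stays put or
    moves right by one cell of the finer grid. *)
Lemma truncn_double {R : realType} (x : R) : 0 <= x ->
  Num.truncn (2 * x) = (Num.truncn x).*2 \/
  Num.truncn (2 * x) = (Num.truncn x).*2.+1.
Proof.
move=> x0; have /andP[] := truncn_itv x0; set k := Num.truncn x => kx xk.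
have : (k.*2 <= Num.truncn (2 * x))%N.
  by rewrite truncn_ge_nat ?mulr_ge0// -mul2n natrM ler_pM2l.
have : (Num.truncn (2 * x) < k.*2.+2)%N.
  by rewrite truncn_lt_nat ?mulr_ge0// -doubleS -mul2n natrM ltr_pM2l.
by move=> ? ?; case: (ltnP (Num.truncn (2 * x)) k.*2.+1) => ?; [left|right]; lia.
Qed.

Lemma powR2X {R : realType} (x : R) (m : nat) : (2 `^ x) ^+ m = (2 ^+ m) `^ x.
Proof.
by rewrite -powR_mulrn ?powR_ge0// -powRrM mulrC powRrM powR_mulrn.
Qed.

Lemma powR2_lt1 {R : realType} (x : R) : x < 0 -> 2 `^ x < 1 :> R.
Proof.
move=> x0; rewrite /powR pnatr_eq0/= expR_lt1 nmulr_rlt0// ln_gt0//.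
by rewrite ltr1n.
Qed.

(** Deterministic half of Kolmogorov's argument. Successive floors of a time are equal or adjacent
    on the finer grid, so [f] converges geometrically along them. Two times are then compared
    through their floors at a level whose mesh matches their distance. *)
Lemma dyadic_chaining {R : realType} (alpha : R) (T : nat) (C : R) (f : R -> R) :
  0 < alpha -> 0 <= C -> (0 < T)%N ->
  (forall m k, (k < T * 2 ^ m)%N ->
     `|f (k.+1%:R / 2 ^+ m) - f (k%:R / 2 ^+ m)| <= C * (2 `^ (- alpha)) ^+ m) ->
  exists (g : R -> R) (M : R),
    (forall t : R, 0 <= t <= T%:R -> f (dyadic_floor m t) @[m --> \oo] --> g t) /\
    forall s t : R, 0 <= s <= T%:R -> 0 <= t <= T%:R ->
      `|g t - g s| <= M * `|t - s| `^ alpha.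
Proof.
move=> a0 C0 T0; set q := 2 `^ (- alpha) => fC.
have q0 : 0 < q by rewrite powR_gt0.
have q1 : q < 1 by apply: powR2_lt1; rewrite oppr_lt0.
have pow2 m : 0 < (2 : R) ^+ m by rewrite exprn_gt0.
have step m k j : (k + j <= T * 2 ^ m)%N ->
    `|f ((k + j)%:R / 2 ^+ m) - f (k%:R / 2 ^+ m)| <= j%:R * (C * q ^+ m).
  elim: j => [|j IH] kj; first by rewrite addn0 subrr normr0 mul0r.
  have -> : j.+1%:R * (C * q ^+ m) = C * q ^+ m + j%:R * (C * q ^+ m).
    by rewrite -natr1; ring.
  rewrite addnS -(subrKA (f ((k + j)%:R / 2 ^+ m))).
  apply: (le_trans (ler_normD _ _)); apply: lerD; first by apply: fC; lia.
  by apply: IH; lia.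
have trT m (t : R) : 0 <= t <= T%:R -> (Num.truncn (2 ^+ m * t) <= T * 2 ^ m)%N.
  move=> /andP[t0 tT]; rewrite -(ler_nat R); apply: (@le_trans _ _ (2 ^+ m * t)).
    by rewrite truncn_le mulr_ge0// ltW.
  by rewrite natrM natrX mulrC ler_pM2r.
have refine (t : R) m : 0 <= t <= T%:R ->
    `|f (dyadic_floor m.+1 t) - f (dyadic_floor m t)| <= C * q ^+ m.
  move=> tT; have t0 : 0 <= t by case/andP: tT.
  have := trT m.+1 _ tT; rewrite /dyadic_floor.
  have -> : (2 : R) ^+ m.+1 * t = 2 * (2 ^+ m * t) by rewrite exprS mulrA.
  set k := Num.truncn (2 ^+ m * t).
  have -> : k%:R / 2 ^+ m = k.*2%:R / 2 ^+ m.+1 :> R.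
    by rewrite -mul2n natrM exprS -mulf_div divff ?mul1r.
  have x0 : 0 <= 2 ^+ m * t by rewrite mulr_ge0// ltW.
  case: (truncn_double _ x0); rewrite -/k => -> kT.
    by rewrite subrr normr0 mulr_ge0// exprn_ge0// ltW.
  apply: (le_trans (fC _ _ kT)).
  by rewrite ler_wpM2l// exprS ler_piMl ?exprn_ge0// ltW.
(* Outside [[0, T]] the choice is free, and the value 0 is supplied. *)
have /choice[g gP] : forall t : R, exists l : R, 0 <= t <= T%:R ->
    f (dyadic_floor m t) @[m --> \oo] --> l /\
    forall m, `|l - f (dyadic_floor m t)| <= C / (1 - q) * q ^+ m.
  move=> t; have [tT|ntT] := pselect (0 <= t <= T%:R); last by exists 0 => /ntT.
  have [l lP] := @geometric_increments_cvg R C q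
    (fun m => f (dyadic_floor m t)) C0 q0 q1 (refine t ^~ tT).
  by exists l.
(* At the comparison level the floors of [s] and [t] are at most [T] cells apart, which gives
   [T%:R * C]; the other term pays for the two tails from the floors to the limits. *)
set K := T%:R * C + 2 * (C / (1 - q)).
have K0 : 0 <= K.
  by rewrite addr_ge0 ?mulr_ge0// invr_ge0 subr_ge0 ltW.
exists g, (K / q); split=> [t tT|]; first exact: (gP t tT).1.
have main (s t : R) : 0 <= s <= T%:R -> 0 <= t <= T%:R -> s < t ->
    `|g t - g s| <= K / q * `|t - s| `^ alpha.
  move=> sT tT st; have d0 : 0 < t - s by rewrite subr_gt0.
  have exm : exists m, 1 <= 2 ^+ m.+1 * (t - s).
    exists (Num.truncn ((t - s)^-1)).
    rewrite -ler_pdivrMr// mul1r (le_trans (ltW (truncnS_gt _)))//.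
    by rewrite -natrX ler_nat ltnW// ltn_expl.
  case: (ex_minnP exm) => m mlo mmin.
  (* At level 0 all floors lie among [0, ..., T]. At a positive level, minimality makes [t - s]
     smaller than one cell, so the indices differ by at most one, and [1 <= T]. *)
  have close : (Num.truncn (2 ^+ m * t) <= Num.truncn (2 ^+ m * s) + T)%N.
    case: m mlo mmin => [|m] mlo mmin.
      by have := trT 0%N t tT; rewrite muln1; lia.
    have hi : 2 ^+ m.+1 * (t - s) < 1.
      by rewrite ltNge; apply/negP => /mmin; rewrite ltnn.
    suff : (Num.truncn (2 ^+ m.+1 * t) < Num.truncn (2 ^+ m.+1 * s) + 2)%N by lia.
    have [s0 t0] : 0 <= s /\ 0 <= t by case/andP: sT; case/andP: tT.
    rewrite truncn_lt_nat ?mulr_ge0// ?exprn_ge0//.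
    have := truncnS_gt (2 ^+ m.+1 * s); rewrite natrD -natr1.
    by move: hi; rewrite mulrBr; lra.
  have mono : (Num.truncn (2 ^+ m * s) <= Num.truncn (2 ^+ m * t))%N.
    by rewrite le_truncn// ler_pM2l// ltW.
  have [_ /(_ m) gs] := gP s sT; have [_ /(_ m) gt] := gP t tT.
  have fts : `|f (dyadic_floor m t) - f (dyadic_floor m s)|
      <= T%:R * C * q ^+ m.
    have := step m _ (Num.truncn (2 ^+ m * t) - Num.truncn (2 ^+ m * s))%N.
    move=> /(_ (Num.truncn (2 ^+ m * s))); rewrite subnKC// => /(_ (trT _ _ tT)).
    move=> /le_trans; apply; rewrite -mulrA ler_wpM2r//.
      by rewrite mulr_ge0// exprn_ge0// ltW.
    by rewrite ler_nat leq_subLR.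
  have gts : `|g t - g s| <= K * q ^+ m.
    have -> : g t - g s = (g t - f (dyadic_floor m t))
      + (f (dyadic_floor m t) - f (dyadic_floor m s))
      - (g s - f (dyadic_floor m s)) by ring.
    apply: (le_trans (ler_normB _ _)).
    apply: (le_trans (lerD (ler_normD _ _) (lexx _))).
    by rewrite /K; lra.
  apply: (le_trans gts); rewrite -mulrA ler_wpM2l//.
  rewrite ler_pdivlMl// -exprS.
  rewrite /q powR2X powRN -[leLHS]mul1r ler_pdivrMr ?powR_gt0// mulrC.
  rewrite gtr0_norm// -powRM ?(ltW d0) ?(ltW (pow2 _))//.
  (* The left side 1 becomes the zeroth power of a base that is at least 1, so monotonicity in the
     exponent concludes. *)
  rewrite -[leLHS](powRr0 (2 ^+ m.+1 * (t - s))).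
  by rewrite ler_powR// ltW.
move=> s t sT tT; have [ts|st|->] := ltgtP t s.
- by rewrite distrC (distrC t); exact: main.
- exact: main.
- by rewrite !subrr normr0 mulr_ge0 ?powR_ge0// divr_ge0// ltW.
Qed.

(** * Almost everywhere convergence from summable integrals *)

(** Plays the role of Markov's inequality with Borel-Cantelli: summing under the integral, the
    series of the [h m] is integrable, hence finite almost everywhere, so its terms tend to 0. *)
Lemma geometric_integral_ae_cvg0 {disp : measure_display}
    {T : measurableType disp} {R : realType}
    (mu : {measure set T -> \bar R}) (h : nat -> T -> R) (K r : R) :
  0 <= r -> r < 1 -> (forall m, measurable_fun setT (h m)) ->
  (forall m x, 0 <= h m x) ->
  (forall m, (\int[mu]_x (h m x)%:E <= (K * r ^+ m)%:E)%E) ->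
  {ae mu, forall x, h ^~ x @ \oo --> (0 : R)}.
Proof.
move=> r0 r1 mh h0 hK.
have mhE m : measurable_fun setT (fun x => (h m x)%:E) by exact/measurable_EFinP.
have hE0 m x : (0 <= (h m x)%:E)%E by rewrite lee_fin.
pose g x := (\sum_(m <oo) (h m x)%:E)%E.
have g0 x : (0 <= g x)%E by apply: nneseries_ge0.
have ig : (\int[mu]_x g x < +oo)%E.
  rewrite integral_nneseries//.
  have K0 m : 0 <= K * r ^+ m.
    by rewrite -lee_fin (le_trans _ (hK m))// integral_ge0.
  apply: (@le_lt_trans _ _ (\sum_(m <oo) (K * r ^+ m)%:E)%E).
    by apply: lee_nneseries => // m _ _; exact: integral_ge0.
  have : cvgn (series (geometric K r)).
    by apply: is_cvg_geometric_series; rewrite ger0_norm.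
  move=> /cvg_ex[l cl].
  have -> : (\sum_(m <oo) (K * r ^+ m)%:E = l%:E)%E; last by rewrite ltry.
  apply/cvg_lim => //.
  under eq_fun do rewrite sumEFin.
  by apply: cvg_EFin => //; exact: nearW.
have gint : mu.-integrable setT g.
  apply/integrableP; split; first exact: ge0_emeasurable_sum.
  by rewrite (eq_integral g)// => x _; rewrite gee0_abs.
have := integrable_ae measurableT gint.
apply: filterS => x /(_ I) gx.
apply: cvg_series_cvg_0; apply: nnseries_is_cvg => //.
by rewrite ltey_eq; move: gx; rewrite /g => ->.
Qed.

(** * Completed sigma-algebras, expectations and norms *)

Section completion.
Context {disp : measure_display} {T : measurableType disp} {R : realType}.
Variable mu : {measure set T -> \bar R}.

(* The completion of the sigma-algebra under [mu]: only the part of [E] outside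
   a null set has to be measurable, as the rest is negligible. *)
Definition completed_sets : set (set T) :=
  [set E | exists N, [/\ measurable N, mu N = 0%E & measurable (E `\` N)]].

Lemma bigcup_null (N : (set T)^nat) : (forall i, measurable (N i)) ->
  (forall i, mu (N i) = 0%E) -> mu (\bigcup_i N i) = 0%E.
Proof.
move=> mN N0; apply: measure_negligible; first exact: bigcup_measurable.
by apply: negligible_bigcup => i; exists (N i); split.
Qed.

Lemma sigma_algebra_completed_sets : sigma_algebra setT completed_sets.
Proof.
split.
- by exists set0; rewrite measure0 setD0; split.
- move=> E [N [mN N0 mE]]; exists N; split=> //.
  have -> : setT `\` E `\` N = ~` N `\` (E `\` N).
    apply/seteqP; split=> x /=; first by move=> [[_ nE] nN]; split=> // -[].
    by move=> [nN nEN]; split=> //; split=> // Ex; apply: nEN.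
  by apply: measurableD => //; exact: measurableC.
- move=> E /choice[N NP]; exists (\bigcup_i N i).
  have mN i : measurable (N i) by have [] := NP i.
  split; first exact: bigcup_measurable.
    by apply: bigcup_null => // i; have [] := NP i.
  have -> : \bigcup_i E i `\` \bigcup_i N i =
            \bigcup_i (E i `\` N i) `\` \bigcup_i N i.
    apply/seteqP; split=> x /= [[i _ Ei] nN]; split=> //; exists i => //.
      by split=> // Nix; apply: nN; exists i.
    by case: Ei.
  apply: measurableD; last exact: bigcup_measurable.
  by apply: bigcup_measurable => i _; have [] := NP i.
Qed.

(** The sets where [f] exceeds a rational determine [f], and each is measurable off a null set. Off
    the countable union [M] of these null sets [f] is measurable; on [M] it is replaced by 0. *)
Lemma completed_measurable_ae_eq (f : T -> R) :
  (forall U : set R, measurable U -> completed_sets (f @^-1` U)) ->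
  exists g : T -> R, measurable_fun setT g /\ {ae mu, forall x, f x = g x}.
Proof.
move=> fC.
(* The null sets are indexed by the codes of rationals, so that their union runs over the naturals;
   a number that codes no rational gets the empty set. *)
have /choice[N NP] : forall k : nat, exists N, [/\ measurable N, mu N = 0%E &
    forall q : rat, pickle q = k -> measurable (f @^-1` `]ratr q, +oo[ `\` N)].
  move=> k; case qk : (unpickle k : option rat) => [q|].
    have [N [mN N0 mf]] := fC `]ratr q, +oo[%classic (measurable_itv _).
    by exists N; split=> // q' qk'; move: qk; rewrite -qk' pickleK => -[->].
  by exists set0; rewrite measure0; split=> // q; move: qk => + qk; rewrite -qk pickleK.
have mN k : measurable (N k) by have [] := NP k.
pose M := \bigcup_k N k.
have mM : measurable M by exact: bigcup_measurable.
exists (fun x => f x * \1_(~` M) x); split; last first.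
  exists M; split=> //; first by apply: bigcup_null => // k; have [] := NP k.
  move=> x /=; apply: contra_notP => nM.
  by rewrite indicE mem_set// mulr1.
apply: (measurability _ (RGenOInfty.measurableE R)) => //.
move=> _ [_ [r ->] <-]; rewrite setTI.
(* Off [M], [r < f x] holds iff some rational [q] satisfies [r < q < f x]. On [M] the function is 0,
   so [M] contributes exactly when [r < 0]. The conditions on [r] are encoded as constant sets, each
   full or empty. *)
have -> : (fun x => f x * \1_(~` M) x) @^-1` `]r, +oo[ =
  \bigcup_(q : rat) (((f @^-1` `]ratr q, +oo[ `\` N (pickle q)) `\` M) `&`
    [set _ | r < ratr q]) `|` (M `&` [set _ | r < 0]).
  apply/seteqP; split=> x /=; rewrite !in_itv/= !andbT indicE.
    have [Mx|nMx] := pselect (M x).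
      by rewrite memNset ?mulr0; [right|case].
    rewrite mem_set// mulr1 => rf; left.
    have [q /andP[rq qf]] := rat_in_itvoo rf.
    exists q => //; split=> //; split=> //; split; first by rewrite /= in_itv/= andbT.
    by move=> Nx; apply: nMx; exists (pickle q).
  move=> [[q _ [[[+ _] nM] rq]]|[Mx r0]].
    by rewrite /= in_itv/= andbT mem_set// mulr1; exact: lt_trans.
  by rewrite memNset ?mulr0//; case.
have mcst (Q : Prop) : measurable [set _ : T | Q].
  have [q|nq] := pselect Q.
    by have -> : [set _ : T | Q] = setT by apply/seteqP; split.
  by have -> : [set _ : T | Q] = set0 by apply/seteqP; split.
apply: measurableU; last exact: measurableI.
apply: bigcupT_measurable_rat => q; apply: measurableI => //.
by apply: measurableD => //; have [_ _] := NP (pickle q); apply.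
Qed.

End completion.

(** An intersection over [PP] is contained in its member at [P], and polar sets are [P]-null, so all
    generators are completed sets. The outer generated sigma-algebra is the one that [mfun_wrt]
    refers to. *)
Lemma Fhat_inf_completed {R : realType} {d : nat}
    (PP : set (probability (Omega R d) R)) (P : probability (Omega R d) R) :
  PP P -> <<s Fhat_inf PP >> `<=` completed_sets P.
Proof.
move=> PPP; have sC := sigma_algebra_completed_sets P.
have nC : null_sets P (@Finf R d) `<=` completed_sets P.
  move=> E [E' [mE' E'0 EE']]; exists E'; split=> //.
  by rewrite (_ : _ `\` _ = set0)//; apply/seteqP; split=> // x [/EE'].
apply: smallest_sub => // E /(_ P PPP); apply: smallest_sub => //.
move=> {}E [|/(_ P PPP)]; last exact: nC.
apply: smallest_sub => // {}E [mE|]; last exact: nC.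
by exists set0; rewrite measure0 setD0; split.
Qed.

(** The function picked by [xget] is almost everywhere equal to [f], hence to [g]; its default value
    cannot occur, since [g] is itself a candidate. *)
Lemma expectation_compl_eq {R : realType} {d : nat}
    (P : probability (Omega R d) R) (f g : Omega R d -> R) :
  measurable_fun setT g -> {ae P, forall w, f w = g w} ->
  expectation_compl P f = (\int[P]_w (g w)%:E)%E.
Proof.
move=> mg fg; rewrite /expectation_compl; case: xgetP => [h _ [mh fh]|]; last first.
  by move=> /(_ g) [].
apply: ae_eq_integral => //; try exact/measurable_EFinP.
by move: fg fh; apply: filterS2 => w -> ->.
Qed.

Lemma measurable_norm_cV {disp : measure_display} {T : measurableType disp}
    {R : realType} {n : nat} (f : T -> 'cV[R]_n) :
  (forall i, measurable_fun setT (fun x => f x i ord0)) ->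
  measurable_fun setT (fun x => `|f x|).
Proof.
move=> mf.
have -> : (fun x => `|f x|) =
    (fun x => \big[Num.max/0]_ij `|f x ij.1 ij.2|).
  by apply/funext => x; rewrite [LHS]mx_normrE.
elim: (index_enum _) => [|ij s IH].
  by under eq_fun do rewrite big_nil; exact: measurable_cst.
under eq_fun do rewrite big_cons.
apply: measurable_maxr => //; apply: measurableT_comp => //.
by rewrite (ord1 ij.2).
Qed.

Lemma cvg_powR_norm0 {R : realType} (p : R) (u : R^nat) : 0 < p ->
  `|u m| `^ p @[m --> \oo] --> (0 : R) -> u @ \oo --> (0 : R).
Proof.
move=> p0 /cvgr0Pnorm_lt up; apply/cvgr0Pnorm_lt => e e0.
have := up (e `^ p) (powR_gt0 _ e0); apply: filterS => m.
rewrite ger0_norm ?powR_ge0//; apply: contraTT; rewrite -!leNgt => em.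
by rewrite ge0_ler_powR ?nnegrE// ltW.
Qed.

(** * Moment bounds along the dyadic grid *)

Section dyadic_increments.
Context {disp : measure_display} {T : measurableType disp} {R : realType}.
Variables (mu : {measure set T -> \bar R}) (Z : R -> T -> R) (p c eps : R).
Hypothesis mZ : forall t, 0 <= t -> measurable_fun setT (Z t).
Hypotheses (p0 : 0 < p) (c0 : 0 <= c) (eps0 : 0 < eps).
(** Only floor errors and single grid cells are estimated, all of length at most 1; for such lengths
    a bound with exponent [n + eps] implies this one. *)
Hypothesis incZ : forall s t, 0 <= s -> 0 <= t -> `|t - s| <= 1 ->
  (\int[mu]_x (`|Z t x - Z s x| `^ p)%:E <= (c * `|t - s| `^ (1 + eps))%:E)%E.

Let minc s t : 0 <= s -> 0 <= t ->
  measurable_fun setT (fun x => `|Z t x - Z s x| `^ p).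
Proof.
move=> s0 t0; apply: (measurableT_comp (measurable_powR _)) => //.
by apply: measurableT_comp => //; apply: measurable_funB; exact: mZ.
Qed.

Let half_expr_le1 m : (2^-1 : R) ^+ m <= 1.
Proof. by rewrite exprn_ile1// invf_le1// ler1n. Qed.

(** The [p]-th moment of the error at level [m] is at most [c * 2^-1 ^+ m], which is summable. *)
Lemma dyadic_floor_ae_cvg (t : R) : 0 <= t ->
  {ae mu, forall x, Z (dyadic_floor m t) x @[m --> \oo] --> Z t x}.
Proof.
move=> t0; have d0 m : 0 <= dyadic_floor m t.
  by have /andP[] := dyadic_floor_itv m t t0.
have half01 : 0 <= (2^-1 : R) /\ (2^-1 : R) < 1 by split; lra.
have := @geometric_integral_ae_cvg0 _ _ _ mu
  (fun m x => `|Z t x - Z (dyadic_floor m t) x| `^ p) c 2^-1 half01.1 half01.2.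
move=> /(_ (fun m => minc _ _ (d0 m) t0) (fun _ _ => powR_ge0 _ _)).
have bound m : (\int[mu]_x (`|Z t x - Z (dyadic_floor m t) x| `^ p)%:E <=
    (c * 2^-1 ^+ m)%:E)%E.
  have dt := dyadic_floor_dist m t t0.
  apply: (le_trans (incZ _ _ (d0 m) t0 (le_trans dt (half_expr_le1 m)))).
  rewrite lee_fin ler_wpM2l//.
  apply: (@le_trans _ _ ((2^-1 ^+ m) `^ (1 + eps))).
    by rewrite ge0_ler_powR ?nnegrE// ?exprn_ge0// addr_ge0// ltW.
  by rewrite ge1r_powR ?exprn_gt0 ?half_expr_le1// ?invr_gt0// lerDl ltW.
move=> /(_ bound); apply: filterS => x /(cvg_powR_norm0 p) => /(_ p0) Zx.
rewrite -(subr0 (Z t x)).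
have -> : (fun m => Z (dyadic_floor m t) x) =
    (fun m => Z t x - (Z t x - Z (dyadic_floor m t) x)).
  by apply/funext => m; rewrite subKr.
by apply: cvgB => //; exact: cvg_cst.
Qed.

Lemma dyadic_increments_ae_le (alpha : R) (N : nat) : 0 < alpha ->
  alpha < eps / p ->
  {ae mu, forall x, exists2 C, 0 <= C & forall m k, (k < N * 2 ^ m)%N ->
     `|Z (k.+1%:R / 2 ^+ m) x - Z (k%:R / 2 ^+ m) x| <=
       C * (2 `^ (- alpha)) ^+ m}.
Proof.
move=> a0; rewrite ltr_pdivlMr// => ap.
have pow2 m : 0 < (2 : R) ^+ m by rewrite exprn_gt0.
have grid0 k m : 0 <= k%:R / (2 : R) ^+ m by rewrite divr_ge0// ltW.
pose D m k x := `|Z (k.+1%:R / 2 ^+ m) x - Z (k%:R / 2 ^+ m) x|.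
have mD m k : measurable_fun setT (fun x => D m k x `^ p) by exact: minc.
pose h m x := (2 `^ (alpha * p)) ^+ m * \sum_(k < N * 2 ^ m) D m k x `^ p.
have w0 m : 0 <= (2 `^ (alpha * p)) ^+ m :> R by rewrite exprn_ge0// powR_ge0.
have h0 m x : 0 <= h m x.
  by rewrite mulr_ge0// sumr_ge0// => k _; exact: powR_ge0.
have mh m : measurable_fun setT (h m).
  by apply: measurable_funM => //; exact: measurable_sum.
have r1 : 2 `^ (alpha * p - eps) < 1 :> R by apply: powR2_lt1; rewrite subr_lt0.
have bound m : (\int[mu]_x (h m x)%:E <=
    (N%:R * c * (2 `^ (alpha * p - eps)) ^+ m)%:E)%E.
  under eq_integral do rewrite EFinM -sumEFin.
  rewrite ge0_integralZl//; last 2 first.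
  - under eq_fun do rewrite sumEFin.
    by apply/measurable_EFinP; exact: measurable_sum.
  - by move=> x _; apply: sume_ge0 => k _; rewrite lee_fin powR_ge0.
  rewrite ge0_integral_sum//; last 2 first.
  - by move=> k; exact/measurable_EFinP.
  - by move=> k x _; rewrite lee_fin powR_ge0.
  have gridd k : k.+1%:R / 2 ^+ m - k%:R / 2 ^+ m = (2 ^+ m)^-1 :> R.
    by rewrite -mulrBl -natr1 addrAC subrr add0r mul1r.
  apply: (@le_trans _ _ (((2 `^ (alpha * p)) ^+ m)%:E *
      \sum_(k < N * 2 ^ m) (c * (2 ^+ m)^-1 `^ (1 + eps))%:E)%E).
    apply: lee_wpmul2l; first by rewrite lee_fin.
    apply: lee_sum => k _; rewrite /D.
    have gn : `|k.+1%:R / 2 ^+ m - k%:R / 2 ^+ m| = (2 ^+ m)^-1 :> R.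
      by rewrite gridd ger0_norm// invr_ge0 ltW.
    have := incZ _ _ (grid0 k m) (grid0 k.+1 m); rewrite gn; apply.
    by rewrite -exprVn half_expr_le1.
  rewrite sumEFin -EFinM lee_fin sumr_const card_ord.
  rewrite -[X in _ * X <= _]mulr_natl natrM natrX.
  (* The factor [(2 ^+ m)^-1] cancels the number of cells per unit of time; [eps] alone is left to
     beat [alpha * p]. *)
  have -> : (2 ^+ m)^-1 `^ (1 + eps) = (2 ^+ m)^-1 * ((2 ^+ m) `^ eps)^-1 :> R.
    rewrite powRD; last by rewrite invr_eq0 (gt_eqF (pow2 m)) implybT.
    rewrite powRr1 ?invr_ge0 ?(ltW (pow2 m))//; congr (_ * _).
    by rewrite -powR_inv1 ?(ltW (pow2 m))// -powRrM mulN1r powRN.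
  have -> : 2 `^ (alpha * p - eps) = 2 `^ (alpha * p) / 2 `^ eps :> R.
    by rewrite powRB// pnatr_eq0 implybT.
  rewrite expr_div_n !powR2X.
  rewrite le_eqVlt; apply/orP; left; apply/eqP.
  have e1 : (2 ^+ m) `^ eps != 0 :> R by rewrite gt_eqF// powR_gt0.
  have e2 : 2 ^+ m != 0 :> R by rewrite gt_eqF.
  by field; rewrite e1 e2.
have := @geometric_integral_ae_cvg0 _ _ _ mu h _ _ (powR_ge0 _ _) r1 mh h0 bound.
apply: filterS => x /cvgP/cvg_seq_bounded/pinfty_ex_gt0[C C0 /= hC].
(* [C] bounds [h], hence [p]-th powers of increments; the constant for the increments is its [p]-th
   root. *)
exists (C `^ p^-1) => [|m k kN]; first exact: powR_ge0.
have Dp : D m k x `^ p <= C * (2 `^ (- (alpha * p))) ^+ m.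
  rewrite powRN exprVn ler_pdivlMr ?exprn_gt0 ?powR_gt0// mulrC.
  apply: le_trans (hC m I); rewrite ger0_norm// /h ler_wpM2l//.
  by rewrite (bigD1 (Ordinal kN))//= lerDl sumr_ge0// => j _; exact: powR_ge0.
have pn0 : p != 0 by rewrite gt_eqF.
have -> : `|Z (k.+1%:R / 2 ^+ m) x - Z (k%:R / 2 ^+ m) x| = (D m k x `^ p) `^ p^-1.
  by rewrite -powRrM divff// powRr1 ?normr_ge0.
apply: (@le_trans _ _ ((C * (2 `^ (- (alpha * p))) ^+ m) `^ p^-1)).
  rewrite ge0_ler_powR ?nnegrE ?invr_ge0 ?powR_ge0 ?(ltW p0)//.
  by rewrite mulr_ge0 ?(ltW C0)// exprn_ge0// powR_ge0.
rewrite powRM ?(ltW C0) ?exprn_ge0 ?powR_ge0// !powR2X -powRrM.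
by rewrite mulNr mulfK.
Qed.

End dyadic_increments.

(** * The pathwise version and its regularity *)

(** An extended-real limsup exists on every path, convergent or not; [fine] turns an infinite value
    into 0. *)
Definition dyadic_limsup {R : realType} {d n : nat} (X : process R d 'cV[R]_n) :
    process R d 'cV[R]_n :=
  fun t w => \col_i
    fine (limn_esup (fun m => (X (dyadic_floor m t) w i ord0)%:E)).

(** Since [0 <= dyadic_floor m s <= s], flooring the time maps [[0, t]] into itself, so each
    approximation stays measurable for [G t], and so does the limsup of the sequence. *)
Lemma progressive_dyadic_limsup {R : realType} {d n : nat}
    (G : R -> set (set (Omega R d))) (X : process R d 'cV[R]_n) :
  progressive G X -> progressive G (dyadic_limsup X).
Proof.
move=> GX t t0 i j.
rewrite (_ : (fun z => _) = fine \o (fun z =>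
    limn_esup (fun m => (X (dyadic_floor m z.1) z.2 i ord0)%:E))); last first.
  by apply/funext => z; rewrite mxE.
have mE : measurable (`[0, t] `*` setT :
    set (measurableTypeR R * g_sigma_algebraType (G t))%type).
  by apply: measurableX => //; exact: measurable_itv.
apply: measurableT_comp; first exact: fine_measurable.
apply: measurable_fun_limn_esup => // m; apply/measurable_EFinP.
have -> : (fun z => X (dyadic_floor m z.1) z.2 i ord0) =
    (fun z => X z.1 z.2 i ord0) \o (fun z => (dyadic_floor m z.1, z.2)) by [].
apply: (measurable_comp mE); last 2 first.
- exact: GX.
- apply: measurable_funTS; apply: measurable_fun_pair => //.
  by apply: measurableT_comp => //; exact: measurable_dyadic_floor.
move=> _ [[s w] [/= + _] <-] /=; rewrite !in_itv/= => /andP[s0 st]; split=> //=.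
have /andP[d0 ds] := dyadic_floor_itv m s s0.
by rewrite d0 (le_trans ds st).
Qed.

Lemma dyadic_limsup_cvg {R : realType} {d n : nat} (X : process R d 'cV[R]_n)
    (t : R) (w : Omega R d) (i : 'I_n) (l : R) :
  X (dyadic_floor m t) w i ord0 @[m --> \oo] --> l ->
  dyadic_limsup X t w i ord0 = l.
Proof.
move=> Xl; rewrite /dyadic_limsup mxE.
have /cvg_limn_einf_sup[_ ->//] :
  (X (dyadic_floor m t) w i ord0)%:E @[m --> \oo] --> l%:E.
by apply: cvg_EFin => //; exact: nearW.
Qed.

Lemma Lhat_ae_measurable {R : realType} {d n : nat} {p : R}
    {PP : set (probability (Omega R d) R)} {P : probability (Omega R d) R}
    {xi : Omega R d -> 'cV[R]_n} :
  PP P -> Lhat PP p xi -> exists zeta : Omega R d -> 'cV[R]_n,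
    (forall i, measurable_fun setT (fun w => zeta w i ord0)) /\
    {ae P, forall w, xi w = zeta w}.
Proof.
move=> PPP [mxi _].
have /choice[z zP] : forall i : 'I_n, exists z : Omega R d -> R,
    measurable_fun setT z /\ {ae P, forall w, xi w i ord0 = z w}.
  move=> i; apply: completed_measurable_ae_eq => U mU.
  apply: (Fhat_inf_completed PP P PPP); rewrite -[_ @^-1` _]setTI.
  exact: (mxi i ord0).
exists (fun w => \col_i z i w); split=> [i|].
  by under eq_fun do rewrite mxE; have [] := zP i.
have : {ae P, forall w i, xi w i ord0 = z i w}.
  by apply: filter_forall => i; have [] := zP i.
by apply: filterS => w xz; apply/colP => i; rewrite mxE.
Qed.

Lemma holder_path_col {R : realType} {n : nat} (alpha : R) (f : R -> 'cV[R]_n) :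
  (forall (N : nat) i, exists M : R, forall s t : R,
     0 <= s <= N%:R -> 0 <= t <= N%:R ->
     `|f t i ord0 - f s i ord0| <= M * `|t - s| `^ alpha) ->
  holder_path alpha f.
Proof.
move=> fM T T0; have TN : T <= (Num.truncn T).+1%:R by rewrite ltW// truncnS_gt.
have /choice[M MP] := fM (Num.truncn T).+1.
(* This constant dominates every [M i] and is nonnegative, as the bound on a maximum over entries
   requires. *)
exists (\sum_i `|M i|) => s t /andP[s0 sT] /andP[t0 tT].
rewrite [leLHS]mx_normrE; apply: bigmax_le => [|[i j] _].
  by rewrite mulr_ge0 ?powR_ge0// sumr_ge0.
rewrite (ord1 j) !mxE; apply: (le_trans (MP i s t _ _)).
- by rewrite s0 (le_trans sT).
- by rewrite t0 (le_trans tT).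
rewrite ler_wpM2r ?powR_ge0// (bigD1 i)//= (le_trans (ler_norm _))// lerDl.
by rewrite sumr_ge0.
Qed.

(** * Assembly under each law *)

Theorem proposition6p2 (R : realType) (d n : nat) (hd : (0 < d)%N)
  (hn : (0 < n)%N) (A0 A : set (process R d 'M[R]_d))
  (hA : separable_class A0 A)
  (X : process R d 'cV[R]_n)
  (hX : progressive (Fhat (laws A)) X)
  (p : R) (hp : 1 < p)
  (hXp : forall t : R, 0 <= t -> Lhat (laws A) p (X t))
  (c eps : process R d 'M[R]_d -> R)
  (hpos : forall a, A a -> 0 < c a /\ 0 < eps a)
  (hinc : forall a, A a -> forall P, is_law a P ->
     forall s t : R, 0 <= s -> 0 <= t ->
       (expectation_compl P (fun w => (`|X t w - X s w| `^ p)%R)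
          <= (c a * `|t - s| `^ (n%:R + eps a))%R%:E)%E) :
  exists Y : process R d 'cV[R]_n,
    [/\ progressive (Fhat (laws A)) Y,
        is_version (laws A) Y X &
        forall a, A a -> forall P, is_law a P ->
          forall alpha : R, 0 < alpha -> alpha < eps a / p ->
            {ae P, forall w, holder_path alpha (fun t => Y t w)}].
Proof.
have p0 : 0 < p by rewrite (lt_trans _ hp).
(* Everything probabilistic is done on [Z], whose increments have genuine integrals; almost sure
   equality at countably many times carries the results back to [X]. *)
have measurable_modification a P : A a -> is_law a P ->
    exists Z : R -> Omega R d -> 'cV[R]_n,
    [/\ forall t, 0 <= t ->
          forall i, measurable_fun setT (fun w => Z t w i ord0),
        forall t, 0 <= t -> {ae P, forall w, X t w = Z t w} &
        forall i s t, 0 <= s -> 0 <= t -> `|t - s| <= 1 ->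
          (\int[P]_w (`|Z t w i ord0 - Z s w i ord0| `^ p)%:E
             <= (c a * `|t - s| `^ (1 + eps a))%:E)%E].
  move=> Aa aP; have lP : laws A P by exists a.
  have [c0 eps0] := hpos a Aa.
  have /choice[Z ZP] : forall t : R, exists Zt : Omega R d -> 'cV[R]_n, 0 <= t ->
      (forall i, measurable_fun setT (fun w => Zt w i ord0)) /\
      {ae P, forall w, X t w = Zt w}.
    move=> t; have [t0|nt0] := pselect (0 <= t); last by exists (cst 0).
    by have [Zt ZtP] := Lhat_ae_measurable lP (hXp t t0); exists Zt.
  exists Z; split=> [t t0|t t0|i s t s0 t0 ts1]; first by have [] := ZP t t0.
    by have [] := ZP t t0.
  have [mZs XZs] := ZP s s0; have [mZt XZt] := ZP t t0.
  have mnorm : measurable_fun setT (fun w => `|Z t w - Z s w| `^ p).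
    apply: (measurableT_comp (measurable_powR _)) => //.
    apply: measurable_norm_cV => k; under eq_fun do rewrite !mxE.
    exact: measurable_funB.
  have XZ : {ae P, forall w, `|X t w - X s w| `^ p = `|Z t w - Z s w| `^ p}.
    by move: XZs XZt; apply: filterS2 => w -> ->.
  have := hinc a Aa P aP s t s0 t0; rewrite (expectation_compl_eq _ _ _ mnorm XZ).
  move=> incZ; apply: (le_trans _ (le_trans incZ _)).
    apply: ge0_le_integral => //.
    - apply/measurable_EFinP.
      apply: (measurableT_comp (measurable_powR _)) => //.
      by apply: measurableT_comp => //; exact: measurable_funB.
    - exact/measurable_EFinP.
    move=> w _; rewrite lee_fin ge0_ler_powR ?nnegrE ?(ltW p0)//.
    rewrite [leRHS]mx_normrE; apply: (le_trans _ (le_bigmax _ _ (i, ord0))).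
    by rewrite !mxE.
  rewrite lee_fin ler_wpM2l ?(ltW c0)//.
  (* For a base in []0, 1]] a larger exponent gives a smaller power, and [1 <= n]; base 0 is treated
     apart. *)
  have [->|ts0] := eqVneq `|t - s| 0.
    by rewrite !powR0// gt_eqF// ltr_pwDr.
  by rewrite ger_powR ?lt0r ?ts0 ?normr_ge0// lerD2r ler1n.
exists (dyadic_limsup X); split; first exact: progressive_dyadic_limsup.
- move=> t t0 P [a Aa aP].
  have [c0 eps0] := hpos a Aa.
  have [Z [mZ XZ incZ]] := measurable_modification a P Aa aP.
  have d0 m : 0 <= dyadic_floor m t by have /andP[] := dyadic_floor_itv m t t0.
  have cvgZ : {ae P, forall w i,
      Z (dyadic_floor m t) w i ord0 @[m --> \oo] --> Z t w i ord0}.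
    apply: filter_forall => i.
    apply: (dyadic_floor_ae_cvg P (fun t w => Z t w i ord0) p (c a) (eps a)) => //.
    - by move=> s s0; exact: mZ.
    - exact: ltW.
    - exact: incZ.
  (* Off one null set [X] and [Z] agree at [t] and at all its floors, so the limsup of [X] is [Z t],
     that is, [X t]. *)
  have := ae_foralln (fun m => XZ _ (d0 m)).
  move: cvgZ (XZ t t0); apply: filterS3 => w cZ XZt XZd.
  apply/colP => i; apply: dyadic_limsup_cvg; rewrite XZt.
  by under eq_fun do rewrite XZd; exact: cZ.
- move=> a Aa P aP alpha alpha0 alphalt.
  have [c0 eps0] := hpos a Aa.
  have [Z [mZ XZ incZ]] := measurable_modification a P Aa aP.
  have grid0 k m : 0 <= k%:R / (2 : R) ^+ m by rewrite divr_ge0// exprn_ge0.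
  have gridXZ : {ae P, forall w m k,
      X (k%:R / 2 ^+ m) w = Z (k%:R / 2 ^+ m) w}.
    by apply: ae_foralln => m; apply: ae_foralln => k; exact: XZ.
  have incs : {ae P, forall w N i, exists2 C, 0 <= C &
      forall m k, (k < N * 2 ^ m)%N ->
        `|Z (k.+1%:R / 2 ^+ m) w i ord0 - Z (k%:R / 2 ^+ m) w i ord0| <=
        C * (2 `^ (- alpha)) ^+ m}.
    apply: ae_foralln => N; apply: filter_forall => i.
    apply: (dyadic_increments_ae_le P (fun t w => Z t w i ord0) p (c a) (eps a)) => //.
    - by move=> s s0; exact: mZ.
    - exact: incZ.
  move: gridXZ incs; apply: filterS2 => w gXZ incs; apply: holder_path_col => N i.
  (* Chaining needs a positive horizon, so [[0, N]] is treated inside [[0, N.+1]]. The limit [g] it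
     yields for [X] coincides there with the version. *)
  have [C C0 incC] := incs N.+1 i.
  have [] := dyadic_chaining alpha N.+1 C (fun t => X t w i ord0) alpha0 C0 isT.
    by move=> m k kN; rewrite !gXZ; exact: incC.
  move=> g [M [Xg gM]].
  have NS (t : R) : 0 <= t <= N%:R -> 0 <= t <= N.+1%:R.
    by move=> /andP[-> /le_trans]; apply; rewrite ler_nat.
  exists M => s t /NS sN /NS tN.
  rewrite (dyadic_limsup_cvg _ _ _ _ _ (Xg _ tN)).
  by rewrite (dyadic_limsup_cvg _ _ _ _ _ (Xg _ sN)) gM.
Qed.
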